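(* Let $A$ be an associative unital algebra over a field $\mathbb K$ of at most countable dimension over $\mathbb K$, and let $\widetilde{\mathbb K}$ be an arbitrary field extension of $\mathbb K$. (a) If $A$ admits a simple module $M$ with trivial annihilator (i.e. $\{a\in A: aM=0\}=(0)$) such that $\mathrm{Hom}_A(M,M)=\mathbb K$, then $A$ is E-CSP. (b) If $A\otimes_{\mathbb K}\widetilde{\mathbb K}$ admits a simple module $M$ with trivial annihilator such that $\mathrm{Hom}_{A\otimes_{\mathbb K}\widetilde{\mathbb K}}(M,M)=\widetilde{\mathbb K}$, then $A$ is E-CSP.
   Context: An associative unital algebra $A$ over a field $\mathbb K$ is called E-CSP (satisfies the extension-stable countable separation property) if there exists a list $a_1,a_2,\ldots$ of elements of $A\setminus\{0\}$ such that for every field extension $\mathbb F$ of $\mathbb K$, every nonzero two-sided ideal of $A\otimes_{\mathbb K}\mathbb F$ contains at least one $a_i$ (where $a_i$ is identified with $a_i\otimes 1$). The list does not depend on $\mathbb F$. The condition $\mathrm{Hom}_A(M,M)=\mathbb K$ means that every $A$-module endomorphism of $M$ is multiplication by a scalar from $\mathbb K$; similarly for $\mathrm{Hom}_{A\otimes_{\mathbb K}\widetilde{\mathbb K}}(M,M)=\widetilde{\mathbb K}$. *)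

(* Defs.v *)
From HB Require Import structures.
From mathcomp Require Import all_boot all_algebra.
From mathcomp Require Import generic_quotient.
From mathcomp Require Import boolp classical_sets cardinality.

Set Implicit Arguments.
Unset Strict Implicit.
Unset Printing Implicit Defensive.

Import GRing.Theory.
Local Open Scope quotient_scope.
Local Open Scope ring_scope.

(* The library has no tensor product of infinite-dimensional algebras and its
   fieldExtType only covers finite extensions.  Here a field extension F of K is
   a ring morphism iota : K -> F, and A (x)_K F is the free commutative monoid on
   A * F (words, with order forgotten) modulo the K-balanced bilinear relations. *)

Section TensorRelation.
Context (K : fieldType) (A : algType K) (F : fieldType).
Context (iota : {rmorphism K -> F}).

Inductive tens_eq : seq (A * F) -> seq (A * F) -> Prop :=
| TensRefl s : tens_eq s s
| TensSym s t : tens_eq s t -> tens_eq t s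
| TensTrans s t u : tens_eq s t -> tens_eq t u -> tens_eq s u
| TensCat s s' t t' : tens_eq s s' -> tens_eq t t' -> tens_eq (s ++ t) (s' ++ t')
| TensComm s t : tens_eq (s ++ t) (t ++ s)
| TensZero x : tens_eq [:: (0, x)] [::]
| TensAddl a b x : tens_eq [:: (a + b, x)] [:: (a, x); (b, x)]
| TensAddr a x y : tens_eq [:: (a, x + y)] [:: (a, x); (a, y)]
| TensScale k a x : tens_eq [:: (k *: a, x)] [:: (a, iota k * x)].

Definition tens_eqb (s t : seq (A * F)) : bool := `[< tens_eq s t >].

Lemma tens_eqb_refl : reflexive tens_eqb.
Proof. by move=> s; apply/asboolP; exact: TensRefl. Qed.

Lemma tens_eqb_sym : symmetric tens_eqb.
Proof.
by move=> s t; apply/idP/idP => /asboolP st; apply/asboolP; exact: TensSym.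
Qed.

Lemma tens_eqb_trans : transitive tens_eqb.
Proof.
move=> t s u /asboolP st /asboolP tu; apply/asboolP; exact: TensTrans st tu.
Qed.

Canonical tens_equiv := EquivRel tens_eqb tens_eqb_refl tens_eqb_sym tens_eqb_trans.
Canonical tens_encModRel := defaultEncModRel tens_eqb.

Definition tensor := {eq_quot tens_eqb}.

HB.instance Definition _ : EqQuotient _ tens_eqb tensor := EqQuotient.on tensor.
HB.instance Definition _ := Choice.on tensor.

Lemma tens_piP s t : tens_eq s t <-> \pi_tensor s = \pi_tensor t.
Proof.
split=> [st|/eqP]; first by apply/eqP; rewrite piE; apply/asboolP.
by rewrite piE => /asboolP.
Qed.

Lemma tens_reprP s : tens_eq (repr (\pi_tensor s)) s.
Proof. by apply/tens_piP; rewrite reprK. Qed.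

Definition tens_zero : tensor := \pi_tensor [::].
Definition tens_add (u v : tensor) : tensor := \pi_tensor (repr u ++ repr v).
Definition tens_opp (u : tensor) : tensor :=
  \pi_tensor [seq (- p.1, p.2) | p <- repr u].

Lemma tens_addE s t : tens_add (\pi_tensor s) (\pi_tensor t) = \pi_tensor (s ++ t).
Proof. by apply/tens_piP; apply: TensCat; exact: tens_reprP. Qed.

Lemma tens_addA : associative tens_add.
Proof.
move=> u v w; rewrite -[u]reprK -[v]reprK -[w]reprK.
rewrite (tens_addE (repr v)) (tens_addE _ (repr v)).
by rewrite (tens_addE _ (repr w)) (tens_addE (repr u)) catA.
Qed.

Lemma tens_addC : commutative tens_add.
Proof. by move=> u v; apply/tens_piP; exact: TensComm. Qed.

Lemma tens_add0 : left_id tens_zero tens_add.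
Proof. by move=> u; rewrite -[u]reprK tens_addE. Qed.

Lemma tens_eq_opp s : tens_eq ([seq (- p.1, p.2) | p <- s] ++ s) [::].
Proof.
elim: s => [|[a x] s IH] /=; first exact: TensRefl.
set n := [seq _ | _ <- s] in IH *.
apply: (@TensTrans _ (([:: (- a, x)] ++ [:: (a, x)]) ++ (n ++ s))).
  rewrite -!catA -cat1s; apply: TensCat; first exact: TensRefl.
  rewrite -(cat1s _ s) !catA; apply: TensCat; first exact: TensComm.
  exact: TensRefl.
apply: (@TensTrans _ ([::] ++ [::])); last exact: TensRefl.
apply: TensCat IH; apply: (TensTrans (TensSym (TensAddl _ _ _))).
by rewrite addNr; exact: TensZero.
Qed.

Lemma tens_addN : left_inverse tens_zero tens_opp tens_add.
Proof.
move=> u; rewrite -{2}[u]reprK /tens_opp tens_addE.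
by apply/tens_piP; exact: tens_eq_opp.
Qed.

HB.instance Definition _ :=
  GRing.isZmodule.Build tensor tens_addA tens_addC tens_add0 tens_addN.

Definition tens (a : A) (x : F) : tensor := \pi_tensor [:: (a, x)].

Lemma tens_addl a b x : tens (a + b) x = tens a x + tens b x.
Proof. by rewrite [RHS]tens_addE; apply/tens_piP; exact: TensAddl. Qed.

Lemma tens_addr a x y : tens a (x + y) = tens a x + tens a y.
Proof. by rewrite [RHS]tens_addE; apply/tens_piP; exact: TensAddr. Qed.

Lemma tens_scale k a x : tens (k *: a) x = tens a (iota k * x).
Proof. by apply/tens_piP; exact: TensScale. Qed.

Lemma tens_piE s : \pi_tensor s = \sum_(p <- s) tens p.1 p.2.
Proof.
elim: s => [|[a x] s IH]; first by rewrite big_nil.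
by rewrite big_cons -IH [RHS]tens_addE.
Qed.

Lemma tens_reprE (u : tensor) : u = \sum_(p <- repr u) tens p.1 p.2.
Proof. by rewrite -tens_piE reprK. Qed.

Lemma tens_ind (P : tensor -> Prop) :
  P 0 -> (forall u v, P u -> P v -> P (u + v)) -> (forall a x, P (tens a x)) ->
  forall u, P u.
Proof. by move=> P0 PD Pt u; rewrite [u]tens_reprE; apply: big_ind. Qed.

Section Lift.
Context (V : zmodType) (f : A -> F -> V).

Definition balanced : Prop :=
  [/\ forall a b x, f (a + b) x = f a x + f b x,
      forall a x y, f a (x + y) = f a x + f a y
    & forall k a x, f (k *: a) x = f a (iota k * x)].

Definition tens_lift (u : tensor) : V := \sum_(p <- repr u) f p.1 p.2.

Context (balf : balanced).

Lemma tens_eq_sum s t :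
  tens_eq s t -> \sum_(p <- s) f p.1 p.2 = \sum_(p <- t) f p.1 p.2.
Proof.
have [fDl fDr fZ] := balf.
elim=> {s t} //.
- by move=> s t u _ -> _ ->.
- by move=> s s' t t' _ IHs _ IHt; rewrite !big_cat /= IHs IHt.
- by move=> s t; rewrite !big_cat /= addrC.
- move=> x; rewrite big_seq1 big_nil /=.
  by apply: (@addIr _ (f 0 x)); rewrite -fDl addr0 add0r.
- by move=> a b x; rewrite big_seq1 big_cons big_seq1 fDl.
- by move=> a x y; rewrite big_seq1 big_cons big_seq1 fDr.
- by move=> k a x; rewrite !big_seq1 /= fZ.
Qed.

Lemma tens_lift_pi s : tens_lift (\pi_tensor s) = \sum_(p <- s) f p.1 p.2.
Proof. by apply: tens_eq_sum; exact: tens_reprP. Qed.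

Lemma tens_liftE a x : tens_lift (tens a x) = f a x.
Proof. by rewrite tens_lift_pi big_seq1. Qed.

Lemma tens_liftD u v : tens_lift (u + v) = tens_lift u + tens_lift v.
Proof.
rewrite -[u]reprK -[v]reprK [\pi_tensor _ + _]tens_addE !tens_lift_pi.
exact: big_cat.
Qed.

Lemma tens_lift0 : tens_lift 0 = 0.
Proof. by rewrite -[0]/(\pi_tensor [::]) tens_lift_pi big_nil. Qed.

End Lift.

Definition tens_one : tensor := tens 1 1.

Definition tens_mul (u v : tensor) : tensor :=
  \sum_(p <- repr u) \sum_(q <- repr v) tens (p.1 * q.1) (p.2 * q.2).

Definition tens_scaler (c : F) (u : tensor) : tensor :=
  \sum_(p <- repr u) tens p.1 (c * p.2).

Let mulr_bal a x : balanced (fun b y => tens (a * b) (x * y)).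
Proof.
split=> *; rewrite ?mulrDr ?tens_addl ?tens_addr //.
by rewrite -scalerAr tens_scale !mulrA [x * _]mulrC.
Qed.

Let mull_bal v :
  balanced (fun a x => tens_lift (fun b y => tens (a * b) (x * y)) v).
Proof.
split; rewrite /tens_lift.
- move=> a b x; rewrite -big_split /=; apply: eq_bigr => p _.
  by rewrite mulrDl tens_addl.
- move=> a x y; rewrite -big_split /=; apply: eq_bigr => p _.
  by rewrite mulrDl tens_addr.
- move=> k a x; apply: eq_bigr => p _.
  by rewrite -scalerAl tens_scale mulrA.
Qed.

Let scaler_bal c : balanced (fun a x => tens a (c * x)).
Proof.
split=> *; rewrite ?mulrDr ?tens_addl ?tens_addr //.
by rewrite tens_scale !mulrA [c * _]mulrC.
Qed.

Lemma tens_mulDl : left_distributive tens_mul +%R.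
Proof. by move=> u v w; exact: (tens_liftD (mull_bal w)). Qed.

Lemma tens_mulDr : right_distributive tens_mul +%R.
Proof.
move=> u v w; rewrite /tens_mul -big_split /=; apply: eq_bigr => p _.
exact: (tens_liftD (mulr_bal _ _)).
Qed.

Lemma tens_mulE a x b y : tens_mul (tens a x) (tens b y) = tens (a * b) (x * y).
Proof.
rewrite [LHS](tens_liftE (mull_bal _)).
exact: (tens_liftE (mulr_bal _ _)).
Qed.

Let mul0t u : tens_mul 0 u = 0.
Proof. exact: (tens_lift0 (mull_bal _)). Qed.

Let mult0 u : tens_mul u 0 = 0.
Proof. by apply: big1 => p _; exact: (tens_lift0 (mulr_bal _ _)). Qed.

Lemma tens_mulA : associative tens_mul.
Proof.
move=> u v w; elim/tens_ind: u => [|u u' IH IH'|a x].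
- by rewrite !mul0t.
- by rewrite !tens_mulDl IH IH'.
elim/tens_ind: v => [|v v' IH IH'|b y].
- by rewrite mul0t !mult0 mul0t.
- by rewrite !(tens_mulDl, tens_mulDr) IH IH'.
elim/tens_ind: w => [|w w' IH IH'|c z].
- by rewrite !mult0.
- by rewrite !tens_mulDr IH IH'.
by rewrite !tens_mulE !mulrA.
Qed.

Lemma tens_mul1l : left_id tens_one tens_mul.
Proof.
elim/tens_ind => [|u u' IH IH'|a x]; first exact: mult0.
- by rewrite tens_mulDr IH IH'.
by rewrite tens_mulE !mul1r.
Qed.

Lemma tens_mul1r : right_id tens_one tens_mul.
Proof.
elim/tens_ind => [|u u' IH IH'|a x]; first exact: mul0t.
- by rewrite tens_mulDl IH IH'.
by rewrite tens_mulE !mulr1.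
Qed.

Lemma unit_functional :
  exists phi : A -> K, [/\ forall a b, phi (a + b) = phi a + phi b,
    forall k a, phi (k *: a) = k * phi a & phi 1 = 1].
Proof.
pose P (S : set A) := (forall k a b, S a -> S b -> S (k *: a + b)) /\ ~ S 1.
have [|H [[Hlin H1] Hmax]] := @Zorn_bigcup A P.
  move=> C CP Ctot; split; last by move=> [S CS]; exact: (CP S CS).2.
  move=> k a b [S CS Sa] [T CT Tb].
  case: (Ctot S T CS CT) => [ST|TS].
    by exists T => //; apply: (CP T CT).1 => //; exact: ST.
  by exists S => //; apply: (CP S CS).1 => //; exact: TS.
have maxH S : P S -> (forall a, H a -> S a) -> forall a, S a -> H a.
  move=> PS HS a Sa; apply: contrapT => nHa; apply: (Hmax S) => //.
  by split=> // /(_ a Sa).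
have H0 : H 0.
  apply: (maxH (fun a => H a \/ a = 0)); try by [right | left].
  split; last by case=> // /eqP; rewrite oner_eq0.
  move=> k a b [Ha|->] [Hb|->].
  - by left; exact: Hlin.
  - left; rewrite addr0; have := Hlin (k - 1) a a Ha Ha.
    by rewrite scalerBl scale1r subrK.
  - by left; rewrite scaler0 add0r.
  - by right; rewrite scaler0 addr0.
have HZ k a : H a -> H (k *: a).
  by move=> Ha; rewrite -[k *: a]addr0; exact: Hlin.
have HD a b : H a -> H b -> H (a + b).
  by move=> Ha Hb; rewrite -[a]scale1r; exact: Hlin.
have ex a : exists k : K, H (a - k *: 1).
  apply: contrapT => nex.
  pose S : set A := fun b => exists k, H (b - k *: a).
  have HS b : H b -> S b by move=> Hb; exists 0; rewrite scale0r subr0.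
  have Sa : S a by exists 1; rewrite scale1r subrr.
  have nHa : ~ H a by move=> Ha; apply: nex; exists 0; rewrite scale0r subr0.
  apply: nHa; apply: (maxH S) => //; split.
    move=> k b c [l Hl] [m Hm]; exists (k * l + m).
    have := Hlin k _ _ Hl Hm.
    by rewrite scalerBr scalerA addrACA -opprD -scalerDl.
  move=> [k Hk]; apply: nex.
  have [k0|k0] := eqVneq k 0; first by move: Hk; rewrite k0 scale0r subr0.
  exists k^-1; have := HZ (- k^-1) _ Hk.
  by rewrite scalerBr scalerA !scaleNr mulNr mulVf // scaleN1r opprK addrC.
have uniq_k (a : A) (k l : K) : H (a - k *: 1) -> H (a - l *: 1) -> k = l.
  move=> Hk Hl; apply/eqP; rewrite -subr_eq0; apply/negPn/negP => kl.
  apply: H1; have := HZ (k - l)^-1 _ (HD _ _ Hl (HZ (-1) _ Hk)).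
  by rewrite scaleN1r opprB [_ + (_ - a)]addrC addrA subrK -scalerBl scalerA mulVf // scale1r.
have [phi phiP] := choice ex.
exists phi; split.
- move=> a b; apply: (uniq_k (a + b)); first exact: phiP.
  by rewrite scalerDl opprD addrACA; apply: HD; exact: phiP.
- move=> k a; apply: (uniq_k (k *: a)); first exact: phiP.
  by rewrite -scalerA -scalerBr; apply: HZ; exact: phiP.
- by apply: (uniq_k 1); [exact: phiP | rewrite scale1r subrr].
Qed.

Lemma tens_one_neq0 : tens_one != 0.
Proof.
have [phi [phiD phiZ phi1]] := unit_functional.
have bal : balanced (fun a x => iota (phi a) * x).
  split=> [a b x|a x y|k a x].
  - by rewrite phiD rmorphD mulrDl.
  - by rewrite mulrDr.
  - by rewrite phiZ rmorphM mulrA [iota k * _]mulrC.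
apply/eqP => /(congr1 (tens_lift (fun a x => iota (phi a) * x))).
rewrite (tens_liftE bal) (tens_lift0 bal) phi1 rmorph1 mulr1.
by move/eqP; rewrite oner_eq0.
Qed.

HB.instance Definition _ := GRing.Zmodule_isNzRing.Build tensor
  tens_mulA tens_mul1l tens_mul1r tens_mulDl tens_mulDr tens_one_neq0.

Lemma tens_scalerE c a x : tens_scaler c (tens a x) = tens a (c * x).
Proof. exact: (tens_liftE (scaler_bal c)). Qed.

Lemma tens_scalerDr : right_distributive tens_scaler +%R.
Proof. by move=> c u v; exact: (tens_liftD (scaler_bal c)). Qed.

Let scalert0 c : tens_scaler c 0 = 0.
Proof. exact: (tens_lift0 (scaler_bal c)). Qed.

Lemma tens_scalerDl v : {morph tens_scaler^~ v : c d / c + d}.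
Proof.
move=> c d; rewrite /tens_scaler -big_split /=; apply: eq_bigr => p _.
by rewrite mulrDl tens_addr.
Qed.

Lemma tens_scalerA c d u : tens_scaler c (tens_scaler d u) = tens_scaler (c * d) u.
Proof.
elim/tens_ind: u => [|u u' IH IH'|a x]; first by rewrite !scalert0.
- by rewrite !tens_scalerDr IH IH'.
by rewrite !tens_scalerE mulrA.
Qed.

Lemma tens_scaler1 : left_id 1 tens_scaler.
Proof.
elim/tens_ind => [|u u' IH IH'|a x]; first exact: scalert0.
- by rewrite tens_scalerDr IH IH'.
by rewrite tens_scalerE mul1r.
Qed.

HB.instance Definition _ := GRing.Zmodule_isLmodule.Build F tensor
  tens_scalerA tens_scaler1 tens_scalerDr tens_scalerDl.

Lemma tens_scalerAl (c : F) (u v : tensor) : c *: (u * v) = (c *: u) * v.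
Proof.
elim/tens_ind: u => [|u u' IH IH'|a x]; first by rewrite !(mul0r, scaler0).
- by rewrite !(mulrDl, scalerDr) IH IH'.
elim/tens_ind: v => [|v v' IH IH'|b y]; first by rewrite !(mulr0, scaler0).
- by rewrite !(mulrDr, scalerDr) IH IH'.
rewrite [tens a x * _]tens_mulE [LHS]tens_scalerE.
by rewrite [_ *: tens a x]tens_scalerE [RHS]tens_mulE mulrA.
Qed.

HB.instance Definition _ := GRing.Lmodule_isLalgebra.Build F tensor tens_scalerAl.

Lemma tens_scalerAr (c : F) (u v : tensor) : c *: (u * v) = u * (c *: v).
Proof.
elim/tens_ind: u => [|u u' IH IH'|a x]; first by rewrite !(mul0r, scaler0).
- by rewrite !(mulrDl, scalerDr) IH IH'.
elim/tens_ind: v => [|v v' IH IH'|b y]; first by rewrite !(mulr0, scaler0).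
- by rewrite !(mulrDr, scalerDr) IH IH'.
rewrite [tens a x * _]tens_mulE [LHS]tens_scalerE.
by rewrite [_ *: tens b y]tens_scalerE [RHS]tens_mulE mulrCA.
Qed.

HB.instance Definition _ := GRing.Lalgebra_isAlgebra.Build F tensor tens_scalerAr.

End TensorRelation.

Arguments tensor {K} A {F} iota.
Arguments tens {K A F} iota a x.

Section Modules.
Context (R : pzRingType).

Definition simple_module (M : lmodType R) : Prop :=
  (exists m : M, m != 0) /\
  (forall N : {pred M}, GRing.submod_closed N -> N =i pred1 0 \/ N =i predT).

Definition trivial_annihilator (M : lmodType R) : Prop :=
  forall a : R, (forall m : M, a *: m = 0) -> a = 0.

Definition two_sided_ideal (I : {pred R}) : Prop :=
  GRing.zmod_closed I /\
  (forall b u : R, u \in I -> b * u \in I /\ u * b \in I).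

End Modules.

(* k%:A *: m is the action of the scalar k on m; the library does not turn a
   B-module into a vector space over the base field of B. *)
Definition scalar_endomorphisms (F : fieldType) (B : algType F) (M : lmodType B) :
  Prop := forall f : {linear M -> M}, exists k : F, forall m : M, f m = k%:A *: m.

Definition linear_basis (K : fieldType) (V : lmodType K) (B : set V) : Prop :=
  (forall (s : seq V) (c : V -> K), uniq s -> (forall v, v \in s -> B v) ->
     \sum_(v <- s) c v *: v = 0 -> forall v, v \in s -> c v = 0) /\
  (forall u : V, exists (s : seq V) (c : V -> K),
     (forall v, v \in s -> B v) /\ u = \sum_(v <- s) c v *: v).

Definition countable_dim (K : fieldType) (V : lmodType K) : Prop :=
  exists B : set V, linear_basis B /\ countable B.

Definition E_CSP (K : fieldType) (A : algType K) : Prop :=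
  exists a : nat -> A, (forall i, a i != 0) /\
    forall (F : fieldType) (iota : {rmorphism K -> F}) (I : {pred tensor A iota}),
      two_sided_ideal I -> (exists u, u \in I /\ u != 0) ->
      exists i, tens iota (a i) 1 \in I.

(* Main.v *)
(* Call A separating if whenever v is not in the span of vs, some
   T = sum_i x_i (x) y_i in A (x) A^op, acting by v |-> sum_i x_i v y_i, kills vs
   but not v.  Given a countable spanning set of A, choose for every finite list
   v :: vs in it with v not in the span of vs such a T, and put T v in the list.
   A nonzero u in an ideal of A (x) F is v (x) x + sum_i vs_i (x) x_i for such a
   list, with x nonzero; hence T u = T v (x) x, and T v (x) 1 lies in the ideal.

   An F-algebra with a faithful simple module with endomorphisms F is separating:
   inductively, if every T killing vs and w also kills v, then T w |-> T v, for T
   killing vs, is a partial bimodule endomorphism, hence a scalar c, and v - c w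
   contradicts the induction hypothesis.  Finally, the property descends from
   A (x) Kt to A by applying a K-linear functional on Kt to the values of T. *)
Require Import Defs.
From HB Require Import structures.
From mathcomp Require Import all_boot all_algebra.
From mathcomp Require Import boolp classical_sets cardinality.

Set Implicit Arguments.
Unset Strict Implicit.
Unset Printing Implicit Defensive.

Import GRing.Theory.
Local Open Scope ring_scope.

(** Recursive on the list, so that inductions peel off one multiple of the head at a time. *)
Fixpoint in_span (K : fieldType) (V : lmodType K) (vs : seq V) (v : V) : Prop :=
  if vs is w :: vs' then exists c : K, in_span vs' (v - c *: w) else v = 0.

(** * Two-sided multiplication operators and separation *)

Section Multiplications.
Context (R : pzRingType).

(* T represents an element of R (x) R^op. *)
Definition mult_op (T : seq (R * R)) (v : R) : R :=
  \sum_(p <- T) p.1 * v * p.2.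

Lemma mult_opB T u v : mult_op T (u - v) = mult_op T u - mult_op T v.
Proof.
by rewrite -sumrB; apply: eq_bigr => p _; rewrite mulrBr mulrBl.
Qed.

Lemma mult_op_cat T U v : mult_op (T ++ U) v = mult_op T v + mult_op U v.
Proof. exact: big_cat. Qed.

Lemma mult_op_mull b T v :
  mult_op [seq (b * p.1, p.2) | p <- T] v = b * mult_op T v.
Proof.
rewrite /mult_op big_map mulr_sumr.
by apply: eq_bigr => p _; rewrite /= !mulrA.
Qed.

Lemma mult_op_mulr b T v :
  mult_op [seq (p.1, p.2 * b) | p <- T] v = mult_op T v * b.
Proof.
rewrite /mult_op big_map mulr_suml.
by apply: eq_bigr => p _; rewrite /= !mulrA.
Qed.

Lemma mult_op_ideal T (I : {pred R}) u :
  two_sided_ideal I -> u \in I -> mult_op T u \in I.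
Proof.
move=> [[I0 IB] IM] Iu; apply: (big_ind (fun x => x \in I)) => //.
  by move=> x y Ix Iy; rewrite -[y]opprK IB // -sub0r IB.
by move=> p _; apply: (IM _ _ _).2; apply: (IM _ _ _).1.
Qed.

End Multiplications.

Lemma mult_opZ (K : fieldType) (A : algType K) T (c : K) (v : A) :
  mult_op T (c *: v) = c *: mult_op T v.
Proof.
by rewrite scaler_sumr; apply: eq_bigr => p _; rewrite -scalerAr -scalerAl.
Qed.

Definition separating (K : fieldType) (A : algType K) : Prop :=
  forall (vs : seq A) (v : A), ~ in_span vs v ->
    exists T, mult_op T v != 0 /\ forall w, w \in vs -> mult_op T w = 0.

(* Martindale's argument that the extended centroid of B is F: a sub-bimodule E
   of B x B that is the graph of a partial map induces an endomorphism of M, by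
   [x *: n |-> y *: n] for [(x, y)] in E. *)
Section ExtendedCentroid.
Context (F : fieldType) (B : algType F) (M : lmodType B).
Context (simM : simple_module M) (annM : trivial_annihilator M).
Context (endM : scalar_endomorphisms M).
Context (E : B -> B -> Prop).
Context (ED : forall x y x' y', E x y -> E x' y' -> E (x + x') (y + y')).
Context (EMl : forall b x y, E x y -> E (b * x) (b * y)).
Context (EMr : forall b x y, E x y -> E (x * b) (y * b)).
Context (E0 : forall y, E 0 y -> y = 0).

Inductive graph : M -> M -> Prop :=
| GraphNil : graph 0 0
| GraphCons x y n m m' :
    E x y -> graph m m' -> graph (x *: n + m) (y *: n + m').

Lemma graphD m m' n n' : graph m m' -> graph n n' -> graph (m + n) (m' + n').
Proof.
move=> mm' nn'; elim: mm' => {m m'} [|x y k m m' Exy _ IH].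
  by rewrite !add0r.
by rewrite -!addrA; exact: GraphCons.
Qed.

Lemma graphZ b m m' : graph m m' -> graph (b *: m) (b *: m').
Proof.
elim=> [|x y k {}m {}m' Exy _ IH]; first by rewrite !scaler0; exact: GraphNil.
by rewrite !scalerDr !scalerA; apply: GraphCons => //; exact: EMl.
Qed.

Lemma graph1 x y n : E x y -> graph (x *: n) (y *: n).
Proof.
move=> Exy; rewrite -[x *: n]addr0 -[y *: n]addr0.
exact: GraphCons Exy GraphNil.
Qed.

(** Both [(x * x', x * y')] and [(x * x', y * x')] lie in [E]; [E0] applies to their difference. *)
Lemma cross_mul x y x' y' : E x y -> E x' y' -> x * y' = y * x'.
Proof.
move=> Exy Exy'; apply/eqP; rewrite -subr_eq0; apply/eqP/E0.
have := ED (EMl x Exy') (EMl (-1) (EMr x' Exy)).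
by rewrite !mulN1r subrr.
Qed.

Lemma cross_graph x y m m' : E x y -> graph m m' -> x *: m' = y *: m.
Proof.
move=> Exy; elim=> [|x' y' k {}m {}m' Exy' _ IH]; first by rewrite !scaler0.
by rewrite !scalerDr IH !scalerA (cross_mul Exy Exy').
Qed.

Lemma centroid_scalar x0 y0 : E x0 y0 -> x0 != 0 ->
  exists c : F, forall x y, E x y -> y = c *: x.
Proof.
move=> Exy0 nz0; have [_ simN] := simM.
(* The domain of [graph] is a submodule; were it zero, [x0] would kill [M]. *)
have graph_total m : exists m', graph m m'.
  pose N : {pred M} := [pred m | `[< exists m', graph m m' >]].
  have [|N0|NT] := simN N.
  - split; first by apply/asboolP; exists 0; exact: GraphNil.
    move=> b m1 m2 /asboolP [m1' G1] /asboolP [m2' G2]; apply/asboolP.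
    by exists (b *: m1' + m2'); apply: graphD => //; exact: graphZ.
  - case/eqP: nz0; apply: annM => n; apply/eqP.
    rewrite -[_ == _]/(_ \in pred1 0) -N0; apply/asboolP.
    by exists (y0 *: n); exact: graph1.
  by apply/asboolP; rewrite -[asbool _]/(m \in N) NT.
(* The values over 0 form a submodule; were it all of [M], [cross_graph] would give
   [x0 *: m' = y0 *: 0 = 0] for every [m']. *)
have graph0 m' : graph 0 m' -> m' = 0.
  pose N : {pred M} := [pred m | `[< graph 0 m >]].
  have [|N0|NT] := simN N.
  - split; first by apply/asboolP; exact: GraphNil.
    move=> b m1 m2 /asboolP G1 /asboolP G2; apply/asboolP.
    have := graphD (graphZ b G1) G2.
    by rewrite scaler0 addr0.
  - move=> G; apply/eqP; rewrite -[_ == _]/(_ \in pred1 0) -N0.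
    exact/asboolP.
  case/eqP: nz0; apply: annM => n.
  have : n \in N by rewrite NT.
  by move/asboolP => /(cross_graph Exy0) ->; rewrite scaler0.
have graph_fun m n n' : graph m n -> graph m n' -> n = n'.
  move=> G G'; apply/eqP; rewrite -subr_eq0; apply/eqP/graph0.
  have := graphD G (graphZ (-1) G').
  by rewrite !scaleN1r subrr.
have [f fP] := choice graph_total.
have f_lin : linear f.
  move=> b m n; apply: (graph_fun (b *: m + n)) => //.
  by apply: graphD => //; exact: graphZ.
pose flin : GRing.isLinear B M M *:%R f :=
  GRing.isLinear.Build _ _ _ _ f f_lin.
pose fL : {linear M -> M} := HB.pack f flin.
have [c fc] := endM fL.
(* [y *: n] and [c%:A *: (x *: n)] are both images of [x *: n], so [y - c *: x] kills [M]. *)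
exists c => x y Exy; apply/eqP; rewrite -subr_eq0; apply/eqP/annM => n.
apply/eqP; rewrite scalerBl subr_eq0 -mulr_algl -scalerA -[_ *: (x *: n)]fc.
by apply/eqP/(graph_fun (x *: n)); [exact: graph1 | exact: fP].
Qed.

End ExtendedCentroid.

(** * Separation from a faithful simple module *)

Lemma simple_separating (F : fieldType) (B : algType F) (M : lmodType B) :
  simple_module M -> trivial_annihilator M -> scalar_endomorphisms M ->
  separating B.
Proof.
move=> simM annM endM; elim=> [|w vs IH] v /= nspan.
  exists [:: (1, 1)]; split=> //.
  by rewrite /mult_op big_seq1 mulr1 mul1r; apply/eqP.
apply: contrapT => nT.
pose L T := forall z, z \in vs -> mult_op T z = 0.
pose E x y := exists T, [/\ L T, x = mult_op T w & y = mult_op T v].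
(* This is the hypothesis [E0] for the relation [E]. *)
have LE0 T : L T -> mult_op T w = 0 -> mult_op T v = 0.
  move=> LT Tw; apply/eqP/negPn/negP => Tv; apply: nT; exists T; split=> // z.
  by rewrite inE => /predU1P [->|/LT].
have [c cP] : exists c : F, forall x y, E x y -> y = c *: x.
  have [[T [LT Tw]]|J0] := pselect (exists T, L T /\ mult_op T w != 0).
    apply: (centroid_scalar simM annM endM _ _ _ _ (x0 := mult_op T w)
              (y0 := mult_op T v)) => //; last by exists T.
    - move=> _ _ _ _ [U [LU -> ->]] [U' [LU' -> ->]]; exists (U ++ U').
      by split; rewrite ?mult_op_cat // => z zvs; rewrite mult_op_cat LU ?LU' ?addr0.
    - move=> b _ _ [U [LU -> ->]]; exists [seq (b * p.1, p.2) | p <- U].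
      by split; rewrite ?mult_op_mull // => z zvs; rewrite mult_op_mull LU ?mulr0.
    - move=> b _ _ [U [LU -> ->]]; exists [seq (p.1, p.2 * b) | p <- U].
      by split; rewrite ?mult_op_mulr // => z zvs; rewrite mult_op_mulr LU ?mul0r.
    - by move=> y [U [LU /esym Uw ->]]; exact: LE0.
  (* Every [T] killing [vs] also kills [w], hence [v], so the scalar 0 serves. *)
  exists 0 => x y [T [LT _ ->]]; rewrite scale0r; apply: LE0 => //.
  by apply/eqP/negPn/negP => Tw; apply: J0; exists T.
have [|T [Tnz LT]] := IH (v - c *: w); first by move=> sp; apply: nspan; exists c.
case/eqP: Tnz; rewrite mult_opB mult_opZ; apply/eqP; rewrite subr_eq0.
by apply/eqP/cP; exists T.
Qed.

(** * Reduced expressions of tensors *)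

Section TensorRepresentation.
Context (K : fieldType) (A : algType K) (F : fieldType).
Context (iota : {rmorphism K -> F}).

Definition tens_sum (r : seq (A * F)) : tensor A iota :=
  \sum_(p <- r) tens iota p.1 p.2.

Lemma tens0l x : tens iota (0 : A) x = 0.
Proof. by apply: (addIr (tens iota 0 x)); rewrite -tens_addl !add0r. Qed.

Lemma tens0r a : tens iota (a : A) 0 = 0.
Proof. by apply: (addIr (tens iota a 0)); rewrite -tens_addr !add0r. Qed.

Lemma tensM (a b : A) x y :
  tens iota a x * tens iota b y = tens iota (a * b) (x * y).
Proof. exact: tens_mulE. Qed.

Lemma tensZ c (a : A) x : c *: tens iota a x = tens iota a (c * x).
Proof. exact: tens_scalerE. Qed.

(** The coefficients of [v] in terms of the first factors move through [iota] into the second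
    factors. *)
Lemma tens_sum_absorb r (v : A) x : in_span (unzip1 r) v ->
  exists r', unzip1 r' = unzip1 r /\ tens iota v x + tens_sum r = tens_sum r'.
Proof.
elim: r v => [|[w y] r IH] v /=.
  by move=> ->; exists [::]; rewrite tens0l add0r.
move=> [c /IH [r' [r'E r'S]]]; exists ((w, iota c * x + y) :: r').
split; first by rewrite /= r'E.
rewrite /tens_sum !big_cons /= -/(tens_sum r) -/(tens_sum r') -r'S.
rewrite tens_addr -tens_scale -{1}[v](subrK (c *: w)) tens_addl.
by rewrite [tens iota (v - _) _ + _]addrC -!addrA; congr (_ + _); rewrite addrCA.
Qed.

(** The head is dropped while its coefficient is zero or its vector can be absorbed by the later
    terms; a nonzero sum cannot run out of terms. The last clause keeps the vectors inside a given
    basis. *)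
Lemma tens_sum_reduced r : tens_sum r != 0 -> exists v x r',
  [/\ tens_sum r = tens_sum ((v, x) :: r'), x != 0, ~ in_span (unzip1 r') v
    & {subset v :: unzip1 r' <= unzip1 r}].
Proof.
(* Induction is on the first factors, since absorption changes the second ones. *)
move vsE: (unzip1 r) => vs; elim: vs r vsE => [|v vs IH] [|[w x] r] //= vsE.
- by rewrite /tens_sum big_nil eqxx.
case: vsE => -> {w} vsE rnz.
have [[x0 nsp]|[r' [r'vs r'S]]] : x != 0 /\ ~ in_span vs v \/
    exists r', unzip1 r' = vs /\ tens_sum ((v, x) :: r) = tens_sum r'.
- have [->|x0] := eqVneq x 0.
    by right; exists r; rewrite vsE /tens_sum big_cons tens0r add0r.
  have [sp|] := pselect (in_span vs v); last by left.
  right; rewrite -vsE in sp; have [r' [r'E r'S]] := tens_sum_absorb x sp.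
  by exists r'; rewrite r'E vsE -r'S /tens_sum big_cons.
- by exists v, x, r; split; rewrite ?vsE.
have [|w [y [r'' [S y0 nsp sub]]]] := IH r' r'vs; first by rewrite -r'S.
exists w, y, r''; split=> //; first by rewrite r'S.
by move=> z /sub zvs; rewrite inE zvs orbT.
Qed.

Lemma mult_op_tens T (v : A) x :
  mult_op [seq (tens iota p.1 1, tens iota p.2 1) | p <- T] (tens iota v x) =
  tens iota (mult_op T v) x.
Proof.
rewrite /mult_op big_map.
elim: T => [|p T IH]; first by rewrite !big_nil tens0l.
by rewrite !big_cons IH tens_addl !tensM mulr1 mul1r.
Qed.

End TensorRepresentation.

(** * The countable list *)

Lemma separating_E_CSP (K : fieldType) (A : algType K) :
  countable_dim A -> separating A -> E_CSP A.
Proof.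
move=> [B [[_ spanB] /countable_injP [code code_inj]]] sepA.
pose inB (s : seq A) := forall v, v \in s -> B v.
pose Q (v : A) (vs : seq A) (a : A) :=
  exists T, a = mult_op T v /\ forall w, w \in vs -> mult_op T w = 0.
have mapcode_inj s t : inB s -> inB t -> map code s = map code t -> s = t.
  elim: s t => [|x s IH] [|y t] //= sB tB [cxy /IH ->].
  - congr (_ :: _); apply: code_inj => //; apply/mem_set.
      by apply: sB; rewrite mem_head.
    by apply: tB; rewrite mem_head.
  - by move=> z zs; apply: sB; rewrite inE zs orbT.
  - by move=> z zs; apply: tB; rewrite inE zs orbT.
(* Entry [i] serves the list [v :: vs] with code [i], unique by [mapcode_inj]; it defaults to 1 if
   there is none. *)
have /choice [a aP] i : exists a : A, a != 0 /\
    forall v vs, inB (v :: vs) -> ~ in_span vs v ->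
      pickle (map code (v :: vs)) = i -> Q v vs a.
  have [[v [vs [vB nsp vi]]]|none] := pselect (exists v vs,
      [/\ inB (v :: vs), ~ in_span vs v & pickle (map code (v :: vs)) = i]).
    have [T [Tv Tvs]] := sepA vs v nsp.
    exists (mult_op T v); split=> // v' vs' vB' _.
    rewrite -vi => /(pcan_inj pickleK) /mapcode_inj -/(_ vB' vB) [-> ->].
    by exists T.
  exists 1; split; first exact: oner_neq0.
  by move=> v vs vB nsp vi; case: none; exists v, vs.
exists a; split=> [i|F iota I idI [u [Iu unz]]]; first exact: (aP i).1.
have [r [rB uE]] : exists r, inB (unzip1 r) /\ u = tens_sum iota r.
  elim/tens_ind: u {Iu unz} => [|u u' [r [rB ->]] [r' [rB' ->]]|b x].
  - by exists [::]; rewrite /tens_sum big_nil.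
  - exists (r ++ r'); rewrite /tens_sum big_cat; split=> // v.
    by rewrite /unzip1 map_cat mem_cat => /orP [/rB|/rB'].
  - have [s [c [sB ->]]] := spanB b.
    exists [seq (v, iota (c v) * x) | v <- s]; split.
      by move=> v; rewrite /unzip1 -map_comp map_id; exact: sB.
    rewrite /tens_sum big_map.
    elim: s {sB} => [|v s IH]; first by rewrite !big_nil tens0l.
    by rewrite !big_cons tens_addl IH tens_scale.
have [|v [x [r' [rE x0 nsp sub]]]] := @tens_sum_reduced _ _ _ iota r.
  by rewrite -uE.
set i := pickle (map code (v :: unzip1 r')).
have [_ /(_ v (unzip1 r') _ nsp erefl) [|T [aT Tr']]] := aP i.
  by move=> z /sub /rB.
exists i; rewrite aT.
set T' := [seq (tens iota p.1 1, tens iota p.2 1) | p <- T].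
(* [T'] kills every term of the reduced form but the first. *)
have T'u : mult_op T' u = tens iota (mult_op T v) x.
  rewrite uE rE /tens_sum big_cons /mult_op.
  transitivity (mult_op T' (tens iota v x) + mult_op T' (tens_sum iota r')).
    by rewrite -big_split; apply: eq_bigr => p _; rewrite mulrDr mulrDl.
  rewrite mult_op_tens -[RHS]addr0; congr (_ + _).
  rewrite /mult_op /tens_sum.
  under eq_bigr do rewrite mulr_sumr mulr_suml.
  rewrite exchange_big /= big_seq big1 // => -[w y] wr'.
  rewrite -/(mult_op T' (tens iota w y)) mult_op_tens Tr' ?tens0l //.
  exact: (map_f fst wr').
(* Left multiplication by [tens iota 1 x^-1] turns the coefficient [x] into 1. *)
have := (idI.2 (tens iota 1 x^-1) _ (mult_op_ideal T' idI Iu)).1.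
by rewrite T'u tensM mul1r mulVf.
Qed.

(** * Linear functionals on the extension field *)

Section RestrictScalars.
Context (K F : fieldType) (iota : {rmorphism K -> F}).

(** A copy of [F] to carry the [K]-algebra structure given by [iota], so that [unit_functional]
    applies. *)
Definition restr_scalars : Type := F.

HB.instance Definition _ := GRing.Field.on restr_scalars.

Let scale (k : K) (x : restr_scalars) : restr_scalars := iota k * x.

Let scaleA k l x : scale k (scale l x) = scale (k * l) x.
Proof. by rewrite /scale rmorphM mulrA. Qed.

Let scale1 : left_id 1 scale.
Proof. by move=> x; rewrite /scale rmorph1 mul1r. Qed.

Let scaleDr : right_distributive scale +%R.
Proof. by move=> k x y; exact: mulrDr. Qed.

Let scaleDl x : {morph scale^~ x : k l / k + l}.
Proof. by move=> k l; rewrite /scale rmorphD mulrDl. Qed.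

HB.instance Definition _ := GRing.Zmodule_isLmodule.Build K restr_scalars
  scaleA scale1 scaleDr scaleDl.

Let scaleAl (k : K) (x y : restr_scalars) : k *: (x * y) = (k *: x) * y.
Proof. exact: mulrA. Qed.

HB.instance Definition _ :=
  GRing.Lmodule_isLalgebra.Build K restr_scalars scaleAl.

Let scaleAr (k : K) (x y : restr_scalars) : k *: (x * y) = x * (k *: y).
Proof. exact: mulrCA. Qed.

HB.instance Definition _ :=
  GRing.Lalgebra_isAlgebra.Build K restr_scalars scaleAr.

(** Divide by [x], then apply a functional taking 1 to 1. *)
Lemma point_functional (x : F) : x != 0 -> exists phi : F -> K,
  [/\ forall y z, phi (y + z) = phi y + phi z,
      forall k y, phi (iota k * y) = k * phi y & phi x = 1].
Proof.
move=> x0; have [phi [phiD phiZ phi1]] := unit_functional restr_scalars.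
exists (fun y => phi (y / x)); split=> [y z|k y|].
- by rewrite mulrDl phiD.
- by rewrite -mulrA; exact: phiZ.
- by rewrite divff.
Qed.

End RestrictScalars.

(** * Descent of separation along a field extension *)

Section Descent.
Context (K : fieldType) (A : algType K) (F : fieldType).
Context (iota : {rmorphism K -> F}) (phi : F -> K).
Context (phiD : forall x y, phi (x + y) = phi x + phi y).
Context (phiZ : forall k x, phi (iota k * x) = k * phi x).

(** This is [id (x) phi]. *)
Definition contract (u : tensor A iota) : A :=
  tens_lift (fun a x => phi x *: a) u.

Let contract_balanced : balanced iota (fun (a : A) x => phi x *: a).
Proof.
split=> [a b x|a x y|k a x]; first exact: scalerDr.
  by rewrite phiD scalerDl.
by rewrite phiZ scalerA mulrC.
Qed.

Lemma contractE a x : contract (tens iota a x) = phi x *: a.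
Proof. exact: (tens_liftE contract_balanced). Qed.

Lemma contractD u v : contract (u + v) = contract u + contract v.
Proof. exact: (tens_liftD contract_balanced). Qed.

Lemma contract0 : contract 0 = 0.
Proof. exact: (tens_lift0 contract_balanced). Qed.

Lemma contract_in_span vs u :
  in_span [seq tens iota v 1 | v <- vs] u -> in_span vs (contract u).
Proof.
elim: vs u => [|w vs IH] u /=; first by move=> ->; exact: contract0.
move=> [c /IH]; rewrite contractD -scaleNr tensZ mulr1 contractE => sp.
(* The witness is [phi c], in the form that contracting [(- c) *: tens iota w 1] produces. *)
by exists (- phi (- c)); rewrite scaleNr opprK.
Qed.

Lemma contract_tens_sum r : in_span (unzip1 r) (contract (tens_sum iota r)).
Proof.
elim: r => [|[a x] r IH] /=; first by rewrite /tens_sum big_nil contract0.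
exists (phi x); rewrite /tens_sum big_cons contractD contractE.
by rewrite addrC addrA addNr add0r.
Qed.

(** On pure tensors, [(a (x) x)(v (x) 1)(b (x) y) = avb (x) xy] contracts to
    [phi (x * y) *: (a * v * b)], again a two-sided multiplication of [v]; additivity in [p] and [q]
    does the rest. *)
Lemma contract_mult_op T : exists T', forall v,
  contract (mult_op T (tens iota v 1)) = mult_op T' v.
Proof.
elim: T => [|[p q] T [T' T'E]].
  by exists [::] => v; rewrite /mult_op !big_nil contract0.
suff [U UE] : exists U, forall v,
    contract (p * tens iota v 1 * q) = mult_op U v.
  exists (U ++ T') => v.
  by rewrite mult_op_cat -UE -T'E /mult_op big_cons contractD.
elim/tens_ind: p => [|p p' [U UE] [U' UE']|a x].
- by exists [::] => v; rewrite /mult_op !mul0r big_nil contract0.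
- by exists (U ++ U') => v; rewrite mult_op_cat -UE -UE' !mulrDl contractD.
elim/tens_ind: q => [|q q' [U UE] [U' UE']|b y].
- by exists [::] => v; rewrite /mult_op !mulr0 big_nil contract0.
- by exists (U ++ U') => v; rewrite mult_op_cat -UE -UE' !mulrDr contractD.
exists [:: (phi (x * y) *: a, b)] => v.
by rewrite /mult_op big_seq1 /= !tensM mulr1 contractE !scalerAl.
Qed.

End Descent.

Lemma in_spanN (K : fieldType) (V : lmodType K) (vs : seq V) v :
  in_span vs v -> in_span vs (- v).
Proof.
elim: vs v => [|w vs IH] v /=; first by move=> ->; rewrite oppr0.
by move=> [c /IH sp]; exists (- c); rewrite scaleNr -opprD.
Qed.

Lemma separating_descent (K : fieldType) (A : algType K) (F : fieldType)
    (iota : {rmorphism K -> F}) :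
  separating (tensor A iota) -> separating A.
Proof.
move=> sepB vs v nsp.
have [|T [Tv Tvs]] := sepB [seq tens iota w 1 | w <- vs] (tens iota v 1).
  (* A functional with [phi 1 = 1] would contract a dependence of [tens iota v 1] to one of [v]. *)
  have [phi [phiD phiZ phi1]] := point_functional iota (oner_neq0 F).
  move=> /(contract_in_span phiD phiZ).
  by rewrite contractE // phi1 scale1r.
have TvE := tens_reprE (mult_op T (tens iota v 1)); rewrite TvE in Tv.
(* For [phi x = 1], the reduced form contracts to [a] plus a combination of the other first factors,
   nonzero because [a] is outside their span. *)
have [a [x [r [rE x0 nspa _]]]] := tens_sum_reduced Tv.
have [phi [phiD phiZ phix]] := point_functional iota x0.
have [T' T'E] := contract_mult_op phiD phiZ T.
exists T'; split; last first.
  move=> w wvs; rewrite -T'E Tvs ?contract0 //.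
  exact: (map_f (fun z => tens iota z 1)).
apply/eqP; rewrite -T'E TvE -/(tens_sum iota _) rE /tens_sum big_cons contractD //.
rewrite contractE //= phix scale1r => /eqP; rewrite addr_eq0 => /eqP aE.
by apply: nspa; rewrite aE; apply: in_spanN; exact: contract_tens_sum.
Qed.

Theorem theorem1 (K : fieldType) (A : algType K) (dimA : countable_dim A)
    (Kt : fieldType) (iota : {rmorphism K -> Kt}) :
  ((exists M : lmodType A,
      simple_module M /\ trivial_annihilator M /\ scalar_endomorphisms M) ->
   E_CSP A) /\
  ((exists M : lmodType (tensor A iota),
      simple_module M /\ trivial_annihilator M /\ scalar_endomorphisms M) ->
   E_CSP A).
Proof.
split=> -[M [simM [annM endM]]]; apply: separating_E_CSP => //.
  exact: simple_separating simM annM endM.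
exact: separating_descent (simple_separating simM annM endM).
Qed.
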